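(* For the scheduling game on $m$ restricted identical machines under the EQUI policy, both the price of anarchy and the strong price of anarchy are $\Theta(\log m)$.
   Context: Restricted identical machines: each job $i$ has a length $p_i>0$ and a set $S_i$ of allowed machines; its processing time is $p_{i,j}=p_i$ for $j\in S_i$ and $p_{i,j}=\infty$ otherwise. A strategy profile $\sigma$ maps jobs to machines; the load of machine $j$ is $\sum_{i:\sigma(i)=j}p_{i,j}$, the makespan is the maximum load, and $\mathrm{OPT}$ is the minimum makespan. Under EQUI the cost of job $i$ with $\sigma(i)=j$ is $c_i=\sum_{i':\sigma(i')=j}\min\{p_{i,j},p_{i',j}\}$ (the sum includes $i$). Nash equilibrium: no job can strictly decrease its cost by a unilateral move; strong Nash equilibrium: no nonempty coalition can move simultaneously so that every member strictly decreases its cost. The (strong) price of anarchy for $m$ machines is the supremum over instances with $m$ machines of (largest makespan of a (strong) Nash equilibrium)/$\mathrm{OPT}$. *)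

(* Defs.v *)
From HB Require Import structures.
From mathcomp Require Import all_boot all_order all_algebra.
From mathcomp Require Import all_classical all_reals all_analysis.

Set Implicit Arguments.
Unset Strict Implicit.
Unset Printing Implicit Defensive.
Import Order.TTheory GRing.Theory Num.Theory.
Import numFieldNormedType.Exports.
Local Open Scope classical_set_scope.
Local Open Scope ring_scope.
Local Open Scope ereal_scope.

(* The last two fields make OPT a positive finite number, so that the ratio
   defining the price of anarchy is meaningful. *)
Record instance (R : realType) (m : nat) := Instance {
  njobs : nat;
  job_len : 'I_njobs -> R;
  allowed : 'I_njobs -> {set 'I_m};
  job_len_gt0 : forall i, (0 < job_len i)%R;
  njobs_gt0 : (0 < njobs)%N;
  allowed_neq0 : forall i, allowed i != finset.set0
}.

Section Game.
Variables (R : realType) (m : nat) (I : instance R m).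

Definition profile := {ffun 'I_(njobs I) -> 'I_m}.

Definition ptime (i : 'I_(njobs I)) (j : 'I_m) : \bar R :=
  if j \in allowed i then (job_len i)%:E else +oo.

Definition load (s : profile) (j : 'I_m) : \bar R :=
  \sum_(i | s i == j) ptime i j.

(* Loads are nonnegative, so 0 is a neutral default for the maximum. *)
Definition makespan (s : profile) : \bar R :=
  \big[Order.max/0]_(j < m) load s j.

Definition opt : \bar R := \big[Order.min/+oo]_(s : profile) makespan s.

Definition equi_cost (s : profile) (i : 'I_(njobs I)) : \bar R :=
  \sum_(i' | s i' == s i) Order.min (ptime i (s i)) (ptime i' (s i)).

Definition nash (s : profile) : bool :=
  [forall i, forall s' : profile,
     [forall k, (k != i) ==> (s' k == s k)] ==>
     ~~ (equi_cost s' i < equi_cost s i)].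

Definition strong_nash (s : profile) : bool :=
  [forall A : {set 'I_(njobs I)}, forall s' : profile,
     (A != finset.set0) && [forall k, (k \notin A) ==> (s' k == s k)] ==>
     ~~ [forall i in A, equi_cost s' i < equi_cost s i]].

(* The value is -oo when no profile satisfies E, so that an instance without
   equilibria does not contribute to the supremum below. *)
Definition worst_makespan (E : pred profile) : \bar R :=
  \big[Order.max/-oo]_(s : profile | E s) makespan s.

End Game.

Definition price_of_anarchy (R : realType) (m : nat) : \bar R :=
  ereal_sup (range (fun I : instance R m =>
    worst_makespan (@nash R m I) / opt I)).

Definition strong_price_of_anarchy (R : realType) (m : nat) : \bar R :=
  ereal_sup (range (fun I : instance R m =>
    worst_makespan (@strong_nash R m I) / opt I)).

Definition ereal_bigTheta (R : realType) (f : nat -> \bar R) (g : nat -> R) :=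
  (\forall m \near \oo, f m \is a fin_num) /\
  (fun m => fine (f m) : R^o) \is 'Theta_\oo (fun m => g m : R^o).

(* Main.v *)
Require Import Defs.
From mathcomp Require Import all_boot all_order all_algebra.
From mathcomp Require Import all_classical all_reals all_analysis.
From mathcomp Require Import lra zify.

(** Upper bound.  Scale so that OPT = 1.  On a machine of load at least [x],
    order the jobs by length: those costing less than [x - 2] do not account
    for the last 2 units of load, so jobs of total length at least 2 cost at
    least [x - 2].  In an equilibrium the optimal schedule places each of them
    on a machine of load at least [x - 3], and at most 1 unit per machine;
    hence the number of machines of load at least [x - 3] is twice the number
    of those of load at least [x], and the makespan is at most
    3 (log2 m + 1).

    Lower bound.  Let [N = trunc_log 2 m].  For every [d < N], each machine
    [x < 2^d] hosts [2^d] jobs of length [2^-d] that are also allowed on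
    machine [x + 2^d], and each machine [2^d <= x < 2^(d+1)] hosts [2^(d+1)]
    jobs of length [2^-d] allowed nowhere else.  Machine 0 has load [N],
    whereas moving every job that can move yields makespan at most 3.  A
    movable job of length [2^-d] pays at most [N - d + 1], and its alternative
    machine already hosts shorter or equally long jobs of total length
    [N - d + 1].  In a coalition a shortest moving job therefore gains
    nothing, because none of those jobs leaves. *)

Set Implicit Arguments.
Unset Strict Implicit.
Unset Printing Implicit Defensive.
Import Order.TTheory GRing.Theory Num.Theory.
Import numFieldNormedType.Exports.

(** * Doubling argument for stable assignments with real-valued loads *)

Section UpperBound.
Local Open Scope ring_scope.
Variables (R : realFieldType) (J : finType) (m : nat).
Variables (p : J -> R) (s o : J -> 'I_m) (M : R).
Hypothesis p_gt0 : forall i, 0 < p i.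
Hypothesis M_gt0 : 0 < M.

Definition rload (f : J -> 'I_m) j : R := \sum_(i | f i == j) p i.
Definition rcost (f : J -> 'I_m) i : R :=
  \sum_(k | f k == f i) Num.min (p i) (p k).

Hypothesis load_opt : forall j, rload o j <= M.
Hypothesis stable : forall i, rcost s i <= rload s (o i) + M.

(** The longest job [t] among those on [j] costing less than [x - 2 * M] pays the full length of
    each of them, so their total length is below [x - 2 * M] and the costly jobs make up the rest of
    the load. *)
Lemma total_costly_jobs j (x : R) :
  2 * M <= x -> x <= rload s j ->
  2 * M <= \sum_(i | (s i == j) && (x - 2 * M <= rcost s i)) p i.
Proof.
move=> x_ge load_ge; set P := fun i => x - 2 * M <= rcost s i.
have split_load : rload s j = \sum_(i | (s i == j) && P i) p i
                            + \sum_(i | (s i == j) && ~~ P i) p i.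
  by rewrite /rload (bigID P).
have [i0 /andP[/eqP si0 Pi0]|cheap0] := pickP (fun i => (s i == j) && ~~ P i);
  last first.
  by rewrite [X in _ + X]big_pred0 // addr0 in split_load; lra.
have [t /andP[/eqP st Pt] tmax] :=
  @arg_maxP _ _ _ i0 (fun i => (s i == j) && ~~ P i) p
    (introT andP (conj (introT eqP si0) Pi0)).
suff : \sum_(i | (s i == j) && ~~ P i) p i <= rcost s t.
  by move: Pt; rewrite /P -ltNge; lra.
rewrite /rcost st [X in _ <= X](bigID P) /= -[X in X <= _]add0r lerD //.
  by apply: sumr_ge0 => i _; rewrite le_min !ltW.
apply: ler_sum => i Pi; rewrite le_min lexx andbT.
exact: tmax.
Qed.

Lemma card_load_ge_double (x : R) : 2 * M <= x ->
  (2 * #|[set j | (x <= rload s j)%R]| <= #|[set j | (x - 3 * M <= rload s j)%R]|)%N.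
Proof.
move=> x_ge.
set A := [set j | (x <= _)%R]; set B := [set j | (x - 3 * M <= _)%R].
have cardE (D : {set 'I_m}) : #|D|%:R * M = \sum_(j in D) M.
  by rewrite sumr_const mulr_natl.
rewrite -(ler_nat R) natrM -(ler_pM2r M_gt0).
(* The jobs of [C] have total length at least [2 * M] per machine of [A]. By [stable], [o] sends
   them all into [B], with at most [M] per machine. *)
pose C := [pred i | (s i \in A) && (x - 2 * M <= rcost s i)].
apply: (@le_trans _ _ (\sum_(i | C i) p i)).
  rewrite (partition_big s (fun j => j \in A)) => [|i /andP[]//].
  rewrite -mulrA cardE mulr_sumr.
  apply: ler_sum => j jA.
  have load_j : x <= rload s j by move: jA; rewrite inE.
  apply: (le_trans (total_costly_jobs x_ge load_j)).
  rewrite le_eqVlt; apply/orP; left; apply/eqP; apply: eq_bigl => i.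
  by rewrite /C /= andbC; case: eqVneq => [->|_]; rewrite ?jA ?andbT ?andbF.
apply: (@le_trans _ _ (\sum_(i | o i \in B) p i)).
  rewrite [X in _ <= X](bigID C) /= [X in _ <= X + _](eq_bigl C).
    by rewrite lerDl sumr_ge0 // => i _; exact: ltW.
  move=> i; apply: andb_idl => /andP[_ ci]; rewrite inE.
  by have := stable i; lra.
rewrite (partition_big o (fun j => j \in B)) //.
rewrite cardE; apply: ler_sum => j jB; apply: le_trans (load_opt j).
rewrite le_eqVlt; apply/orP; left; apply/eqP; apply: eq_bigl => i.
by case: eqP => [->|]; rewrite ?jB ?andbF.
Qed.

Lemma card_load_ge_exp (k : nat) (x : R) : (3 * M) *+ k <= x ->
  (2 ^ k * #|[set j | (x <= rload s j)%R]|
     <= #|[set j | (x - (3 * M) *+ k <= rload s j)%R]|)%N.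
Proof.
elim: k x => [|k IHk] x; first by rewrite mulr0n subr0 mul1n.
rewrite mulrS => x_ge.
have kM : 0 <= (3 * M) *+ k by rewrite mulrn_wge0 // mulr_ge0 // ltW.
have x2 : 2 * M <= x by have := M_gt0; lra.
rewrite expnSr -mulnA (leq_trans (leq_mul (leqnn _) (card_load_ge_double x2))) //.
by rewrite opprD addrA; apply: IHk; lra.
Qed.

(** A counterexample [j] would itself start the doubling, and [(trunc_log 2 m).+1] rounds would
    yield more than [m] machines. *)
Lemma stable_load_lt j : rload s j < (3 * M) *+ (trunc_log 2 m).+1.
Proof.
rewrite ltNge; apply/negP => /card_load_ge_exp.
have m_gt0 : (0 < m)%N by case: (m) j => [[]|].
have /andP[_ m_lt] := @trunc_log_bounds 2 m isT m_gt0.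
have A_gt0 : (0 < #|[set k | (rload s j <= rload s k)%R]|)%N.
  by apply/card_gt0P; exists j; rewrite inE.
have := max_card [set k | (rload s j - (3 * M) *+ (trunc_log 2 m).+1 <= rload s k)%R].
rewrite card_ord => le_m /leq_trans/(_ le_m).
move=> /(leq_trans (leq_pmulr _ A_gt0)); lia.
Qed.

End UpperBound.

(** * Feasibility, attainment of the optimum, and the ratio bound for equilibria *)

Section Instance.
Local Open Scope ring_scope.
Variables (R : realType) (m : nat) (I : instance R m).
Local Notation job := 'I_(njobs I).
Local Notation p := (@job_len R m I).
Implicit Types (f s : profile I) (i : job) (j : 'I_m).

Definition feasible f := forall i, f i \in allowed i.

Lemma ptime_allowed i j : j \in allowed i -> ptime i j = (p i)%:E.
Proof. by rewrite /ptime => ->. Qed.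

Lemma ptime_gt0 i j : (0 < ptime i j)%E.
Proof. by rewrite /ptime; case: ifP => // _; rewrite lte_fin job_len_gt0. Qed.

Lemma load_feasible f j : feasible f -> load f j = (rload p f j)%:E.
Proof.
move=> ff; rewrite /load /rload -sumEFin.
by apply: eq_bigr => i /eqP <-; exact: ptime_allowed.
Qed.

Lemma equi_cost_feasible f i : feasible f -> equi_cost f i = (rcost p f i)%:E.
Proof.
move=> ff; rewrite /equi_cost /rcost -sumEFin.
apply: eq_bigr => k /eqP fk; rewrite EFin_min ptime_allowed //.
by rewrite ptime_allowed // -fk.
Qed.

Lemma makespan_feasible f : feasible f ->
  makespan f = (\big[Num.max/0]_(j < m) rload p f j)%:E.
Proof.
move=> ff; rewrite (big_morph EFin EFin_max (erefl 0%:E)).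
by apply: eq_bigr => j _; exact: load_feasible.
Qed.

Lemma load_le_makespan f j : (load f j <= makespan f)%E.
Proof. exact: le_bigmax. Qed.

Lemma load_infeasible f i : f i \notin allowed i -> load f (f i) = +oo%E.
Proof.
move=> fi; apply/eqP; rewrite /load esum_eqy => [|k _].
  by apply/existsP; exists i; rewrite unfold_in eqxx /ptime (negPf fi).
by rewrite -ltNye (lt_trans _ (ptime_gt0 _ _)) // ltNye.
Qed.

Lemma makespan_fin_feasible f : (makespan f < +oo)%E -> feasible f.
Proof.
move=> mf i; apply/negPn/negP => /load_infeasible lf.
by have := le_lt_trans (load_le_makespan f (f i)) mf; rewrite lf ltxx.
Qed.

Lemma makespan_gt0 f : (0 < makespan f)%E.
Proof.
pose i := Ordinal (njobs_gt0 I).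
apply: lt_le_trans (load_le_makespan f (f i)).
rewrite /load (bigD1 i) //= (lt_le_trans (ptime_gt0 i (f i))) //.
by apply/leeDl/sume_ge0 => k _; exact/ltW/ptime_gt0.
Qed.

Lemma opt_le f : (opt I <= makespan f)%E.
Proof. exact: bigmin_le. Qed.

Lemma opt_attained : exists o : profile I, exists M : R,
  [/\ feasible o, 0 < M, opt I = M%:E & forall j, rload p o j <= M].
Proof.
have allowedP i : exists j, j \in allowed i.
  by apply/set0Pn; exact: allowed_neq0.
pose f : profile I := [ffun i => xchoose (allowedP i)].
have ff : feasible f by move=> i; rewrite ffunE; exact: xchooseP.
(* The default [+oo] is never below a makespan, so some profile attains the minimum; comparison with
   [f] makes it finite, hence feasible. *)
have optE : opt I = makespan [arg min_(g < f) makespan g]%O.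
  by apply: bigmin_eq_arg => // g _; exact: leey.
set o := Order.arg_min _ _ _ in optE.
have fo : feasible o.
  apply: makespan_fin_feasible; rewrite -optE (le_lt_trans (opt_le f)) //.
  by rewrite makespan_feasible // ltry.
exists o, (\big[Num.max/0]_(j < m) rload p o j).
split=> //; first by rewrite -lte_fin -makespan_feasible // makespan_gt0.
  by rewrite optE makespan_feasible.
by move=> j; exact: le_bigmax.
Qed.

(** The own term of [i] is infinite on a forbidden machine; on an allowed one the length of [i] caps
    every term. *)
Lemma equi_cost_fin f i : (equi_cost f i < +oo)%E = (f i \in allowed i).
Proof.
have [fi|fi] := boolP (f i \in allowed i).
  rewrite /equi_cost; apply: lte_sum_pinfty => k _.
  by rewrite ptime_allowed // gt_min ltry.
apply/negbTE; rewrite -leNgt leye_eq /equi_cost esum_eqy => [|k _].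
  by apply/existsP; exists i; rewrite unfold_in eqxx /ptime (negPf fi) minxx.
by rewrite -ltNye lt_min !(lt_trans _ (ptime_gt0 _ _)) // ltNye.
Qed.

Lemma strong_nash_nash f : strong_nash f -> nash f.
Proof.
move/forallP=> sf; apply/forallP => i; apply/forallP => f'; apply/implyP.
move=> /forallP f'P; have /forallP/(_ f')/implyP := sf [set i].
move=> H; apply: contra (H _) => [lt|].
  by apply/forallP => k; apply/implyP; rewrite inE => /eqP ->.
apply/andP; split; first by apply/set0Pn; exists i; rewrite inE.
by apply/forallP => k; rewrite inE; exact: f'P.
Qed.

Definition deviate f i j : profile I := [ffun k => if k == i then j else f k].

Lemma nash_deviate f i j : nash f -> (equi_cost f i <= equi_cost (deviate f i j) i)%E.
Proof.
move=> /forallP/(_ i)/forallP/(_ (deviate f i j))/implyP nf; rewrite leNgt; apply: nf.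
by apply/forallP => k; apply/implyP => /negPf ki; rewrite ffunE ki.
Qed.

Lemma nash_feasible f : nash f -> feasible f.
Proof.
move=> nf i; have /set0Pn[j ij] := allowed_neq0 i.
rewrite -equi_cost_fin (le_lt_trans (nash_deviate i j nf)) // equi_cost_fin.
by rewrite ffunE eqxx.
Qed.

(** After the move, each minimum in the cost of [i] is at most the length of the job it runs over,
    so the cost is at most the total length then on [j]. *)
Lemma nash_stable f i j : nash f -> j \in allowed i ->
  rcost p f i <= rload p f j + p i.
Proof.
move=> nf ij; have ff := nash_feasible nf.
have fd : feasible (deviate f i j).
  by move=> k; rewrite ffunE; case: eqP => [->|].
have := nash_deviate i j nf; rewrite !equi_cost_feasible // lee_fin.
move=> /le_trans; apply; rewrite /rcost {1}ffunE eqxx.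
apply: (@le_trans _ _ (\sum_(k | deviate f i j k == j) p k)).
  by apply: ler_sum => k _; rewrite ge_min lexx orbT.
rewrite (bigD1 i) /= ?ffunE ?eqxx // addrC lerD2r /rload.
(* If [i] is already on [j], its length only increases the right-hand side. *)
rewrite [X in _ <= X](bigID (fun k => k != i)) /= -[X in X <= _]addr0 lerD //.
  rewrite le_eqVlt; apply/orP; left; apply/eqP; apply: eq_bigl => k.
  by rewrite ffunE; case: (k == i); rewrite ?andbF.
by apply: sumr_ge0 => k _; exact/ltW/job_len_gt0.
Qed.

Lemma nash_ratio_le :
  (worst_makespan (@nash R m I) / opt I <= (3 * (trunc_log 2 m).+1%:R)%:E)%E.
Proof.
have [b [M [fb M_gt0 optE loadM]]] := opt_attained.
rewrite optE inver gt_eqF // lee_pdivrMr //; apply: bigmax_le => [|f nf].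
  exact: leNye.
apply: bigmax_le => [|j _].
  by rewrite -EFinM lee_fin !mulr_ge0 // ltW.
rewrite (load_feasible _ (nash_feasible nf)) -EFinM lee_fin ltW //.
rewrite mulrAC mulr_natr.
apply: (@stable_load_lt _ _ _ p f b M (@job_len_gt0 R m I) M_gt0 loadM).
(* The own length of [i] is at most [M], being part of the load of [b i] in the optimal profile. *)
move=> i; apply: (le_trans (nash_stable nf (fb i))); rewrite lerD2l.
apply: le_trans (loadM (b i)); rewrite /rload (bigD1 i) //= lerDl.
by apply: sumr_ge0 => k _; exact/ltW/job_len_gt0.
Qed.

End Instance.

(** * The lower bound instance and its strong equilibrium *)

Definition copies (x d : nat) : nat :=
  if x < 2 ^ d then 2 ^ d else if x < 2 ^ d.+1 then 2 ^ d.+1 else 0.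

(** An immovable job is encoded by an alternative equal to its home. *)
Definition alternative (x d : nat) : nat := if x < 2 ^ d then x + 2 ^ d else x.

(** If [2 ^ k <= x < 2 ^ k.+1 <= 2 ^ d], the nonzero terms are [2 ^ k.+1] at [k], then
    [2 ^ k.+1, ..., 2 ^ d.-1], with sum [2 ^ d]. Thus the longer jobs at home on [x], each charged
    only [2 ^- d], cost a job of that length at most 1. *)
Lemma sum_copies_le x d :
  \sum_(e < d) copies x e <= if x < 2 ^ d then 2 ^ d else 0.
Proof.
elim: d => [|d IHd]; first by rewrite big_ord0.
rewrite big_ord_recr /=; move: IHd; set S := bigop.body _ _ _.
rewrite /copies expnS; move: (2 ^ d) => a.
by case: (ltnP x a); case: (ltnP x (2 * a)); lia.
Qed.

Lemma sum_at_most_one (R : numDomainType) (T : finType) (P : pred T) (c : R) :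
  (0 <= c)%R -> (forall t u, P t -> P u -> t = u) -> (\sum_(t | P t) c <= c)%R.
Proof.
move=> c0 uniqP; have [t Pt|P0] := pickP P; last by rewrite big_pred0.
rewrite (bigD1 t) //= big_pred0 ?addr0 // => u.
by apply/negP => /andP[Pu /eqP]; apply; exact: uniqP.
Qed.

Section LowerBound.
Local Open Scope ring_scope.
Variables (R : realType) (m N : nat).
Hypothesis N_gt0 : (0 < N)%N.
Hypothesis le_m : (2 ^ N <= m)%N.

Definition tree_job : finType :=
  {t : 'I_m * 'I_N & 'I_(copies (nat_of_ord t.1) (nat_of_ord t.2))}.
Local Notation n := #|tree_job|.

Definition home (i : 'I_n) : 'I_m := (tag (enum_val i)).1.
Definition depth (i : 'I_n) : 'I_N := (tag (enum_val i)).2.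
(* The alternative machine is always below [m] (see [val_away]), so the default value
   of [insubd] is not reached. *)
Definition away (i : 'I_n) : 'I_m :=
  insubd (home i) (alternative (home i) (depth i)).
Definition size_at (d : nat) : R := (2 ^+ d)^-1.

Lemma size_at_gt0 d : 0 < size_at d.
Proof. by rewrite invr_gt0 exprn_gt0. Qed.

Lemma size_atM d : size_at d *+ 2 ^ d = 1.
Proof. by rewrite -mulr_natr natrX mulVf // expf_neq0. Qed.

Lemma size_at_le d e : (d <= e)%N -> size_at e <= size_at d.
Proof. by move=> de; rewrite lef_pV2 ?posrE ?exprn_gt0 // ler_weXn2l // ler1n. Qed.

Lemma tree_job_gt0 : (0 < n)%N.
Proof.
have m_gt0 : (0 < m)%N by apply: leq_trans le_m; rewrite expn_gt0.
apply/card_gt0P.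
by exists (@Tagged _ (Ordinal m_gt0, Ordinal N_gt0)
  (fun t => 'I_(copies (nat_of_ord t.1) (nat_of_ord t.2)))
  (Ordinal (isT : 0 < copies 0 0)%N)).
Qed.

Definition tree_allowed (i : 'I_n) : {set 'I_m} := [set home i; away i].

Lemma tree_allowed_neq0 i : tree_allowed i != finset.set0.
Proof. by apply/set0Pn; exists (home i); rewrite !inE eqxx. Qed.

Definition tree_instance : instance R m :=
  @Instance R m n (fun i => size_at (depth i)) tree_allowed
    (fun i => size_at_gt0 (depth i)) tree_job_gt0 tree_allowed_neq0.

Lemma val_away i : val (away i) = alternative (home i) (depth i).
Proof.
rewrite /away val_insubd /alternative; case: ifP => //.
case: ifP => // lt_x /negP[]; apply: leq_trans le_m.
have : (2 ^ (depth i).+1 <= 2 ^ N)%N by rewrite leq_exp2l.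
by rewrite expnS; lia.
Qed.

(** Copies of a pair are interchangeable; this removes the numbering by [enum_val] from load and
    cost computations. *)
Lemma sum_tree_jobs (P : pred ('I_m * 'I_N)) (F : 'I_m * 'I_N -> R) :
  \sum_(i < n | P (home i, depth i)) F (home i, depth i) =
  \sum_(t | P t) F t *+ copies t.1 t.2.
Proof.
transitivity (\sum_(a : tree_job | P (tag a)) F (tag a)).
  rewrite [RHS]big_mkcond [RHS](big_enum_val (A := predT)) [LHS]big_mkcond.
  by apply: eq_bigr => i _; rewrite /home /depth -surjective_pairing.
transitivity (\sum_(t | P t)
    \sum_(r : 'I_(copies (nat_of_ord t.1) (nat_of_ord t.2)) | true) F t).
  by rewrite sig_big_dep /=; apply: eq_bigl => a; rewrite andbT.
by apply: eq_bigr => t _; rewrite sumr_const card_ord.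
Qed.

Lemma sum_home (x : 'I_m) (Q : pred 'I_N) (F : 'I_N -> R) :
  \sum_(i < n | (home i == x) && Q (depth i)) F (depth i) =
  \sum_(d | Q d) F d *+ copies x d.
Proof.
rewrite (sum_tree_jobs (fun t => (t.1 == x) && Q t.2) (fun t => F t.2)).
rewrite -(pair_big_dep (pred1 x) (fun _ => Q) (fun y d => F d *+ copies y d)).
by rewrite big_pred1_eq.
Qed.

Definition home_profile : profile tree_instance := finfun home.
Definition away_profile : profile tree_instance := finfun away.

Lemma home_feasible : feasible home_profile.
Proof. by move=> i; rewrite ffunE !inE eqxx. Qed.

Lemma away_feasible : feasible away_profile.
Proof. by move=> i; rewrite ffunE !inE eqxx orbT. Qed.

Lemma copies_small (x d : nat) : (x < 2 ^ d)%N -> size_at d *+ copies x d = 1.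
Proof. by move=> xd; rewrite /copies xd size_atM. Qed.

Lemma sum_ge1 d : \sum_(e < N | (d <= e)%N) 1 = (N - d)%:R :> R.
Proof. by rewrite -(big_geq_mkord d N predT (fun=> 1)) sumr_const_nat. Qed.

(** Each depth from that of [i] on contributes its full total length 1; the longer jobs together add
    at most 1 by [sum_copies_le]. *)
Lemma home_cost_le (i : 'I_n) : (home i < 2 ^ depth i)%N ->
  rcost (@job_len R m tree_instance) home_profile i <= (N - depth i).+1%:R.
Proof.
move=> lt_x; set x := home i in lt_x *; set d := depth i in lt_x *.
rewrite /rcost /= ffunE.
under eq_bigl => k do rewrite ffunE -[_ == _]andbT.
rewrite (sum_home x predT (fun e => Num.min (size_at d) (size_at e))).
rewrite (bigID (fun e : 'I_N => (e < d)%N)) /= -natr1 addrC lerD //.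
  rewrite (eq_bigr (fun=> 1)) => [|e]; last first.
    rewrite -leqNgt => le_de; rewrite min_r ?size_at_le // copies_small //.
    by apply: leq_trans lt_x _; rewrite leq_exp2l.
  by rewrite (eq_bigl (fun e : 'I_N => d <= e)%N) ?sum_ge1 // => e; rewrite -leqNgt.
rewrite (eq_bigr (fun e : 'I_N => size_at d *+ copies x e)) => [|e lt_e]; last first.
  by rewrite min_l // size_at_le // ltnW.
rewrite sumrMnr -(size_atM d) ler_wpMn2l ?ltW ?size_at_gt0 //.
have := sum_copies_le x d; rewrite lt_x.
by rewrite (big_ord_widen _ (copies x) (ltnW (ltn_ord d))).
Qed.

Lemma deviation_cost_ge (s : profile tree_instance) (i : 'I_n) (v : 'I_m) :
  s i = v -> (2 ^ depth i <= v < 2 ^ (depth i).+1)%N ->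
  (forall k, home k = v -> (depth i <= depth k)%N -> s k = v) ->
  (N - depth i).+1%:R <= rcost (@job_len R m tree_instance) s i.
Proof.
move=> si /andP[le_v lt_v] stay; set d := depth i in le_v lt_v stay *.
rewrite /rcost si (bigID (fun k => (home k == v) && (d <= depth k)%N)) /=.
rewrite -[X in X <= _]addr0 lerD //; last first.
  by apply: sumr_ge0 => k _; rewrite le_min !ltW ?size_at_gt0.
rewrite (eq_bigl (fun k => (home k == v) && (d <= depth k)%N)); last first.
  by move=> k; apply: andb_idl => /andP[/eqP hk dk]; apply/eqP; exact: stay.
rewrite (eq_bigr (fun k => size_at (depth k))) => [|k /andP[_ dk]]; last first.
  by rewrite min_r // size_at_le.
rewrite (sum_home v (fun e => d <= e)%N (fun e => size_at e)).
(* Depth [d] contributes 2, since [v] hosts [2 ^ d.+1] jobs of that depth; each of the [N - d.+1]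
   greater depths contributes 1. *)
rewrite (bigD1 d) //= -(subnSK (ltn_ord d)).
rewrite (eq_big (fun e : 'I_N => d < e)%N (fun=> 1)); last 2 first.
- by move=> e; rewrite ltn_neqAle eq_sym andbC.
- move=> e /andP[de ne]; rewrite copies_small // (leq_trans lt_v) //.
  by rewrite leq_exp2l // ltn_neqAle de eq_sym ne.
rewrite sum_ge1 /copies ltnNge le_v lt_v expnSr mulrnA size_atM.
by rewrite -natrD ler_nat.
Qed.

Lemma home_strong_nash : strong_nash home_profile.
Proof.
apply/forallP => A; apply/forallP => s; apply/implyP => /andP[/set0Pn[a aA]].
move=> /forallP stay; apply/negP => /forallP better.
have {}stay k : k \notin A -> s k = home k.
  by move=> kA; have := implyP (stay k) kA; rewrite ffunE => /eqP.
have {}better k : k \in A -> (equi_cost s k < equi_cost home_profile k)%E.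
  exact/implyP/better.
have fs : feasible s.
  move=> k; have [kA|/stay ->] := boolP (k \in A); last by rewrite !inE eqxx.
  by rewrite -equi_cost_fin (lt_le_trans (better _ kA)) // leey.
have costs k : k \in A -> rcost (@job_len R m tree_instance) s k <
    rcost (@job_len R m tree_instance) home_profile k.
  move=> /better; rewrite !equi_cost_feasible ?lte_fin //; exact: home_feasible.
(* If no job moves, no cost changes, contrary to the strict gain of [a]. *)
have [i0 mv0|still] := pickP (fun k => s k != home k); last first.
  have sE : s = home_profile.
    by apply/ffunP => k; rewrite ffunE; apply/eqP/negbNE; rewrite still.
  by have := better a aA; rewrite sE ltxx.
(* A deepest moving job is a shortest one. *)
have [i mvi imax] := @arg_maxP _ _ _ i0 (fun k => s k != home k)
  (fun k => nat_of_ord (depth k)) mv0.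
have siE : s i = away i.
  by have := fs i; rewrite !inE (negPf mvi) => /eqP.
have lt_x : (home i < 2 ^ depth i)%N.
  rewrite ltnNge; apply/negP => le_x; move: mvi; rewrite siE -val_eqE val_away.
  by rewrite /alternative ltnNge le_x eqxx.
have vE : val (away i) = (home i + 2 ^ depth i)%N.
  by rewrite val_away /alternative lt_x.
have iA : i \in A by apply: contraNT mvi => /stay ->.
have := costs i iA; rewrite ltNge => /negP[].
apply: (le_trans (home_cost_le lt_x)); apply: deviation_cost_ge siE _ _.
  by rewrite vE expnS; lia.
(* If such a [k] moved, maximality would give it the depth of [i]; but its home [away i] is at least
   [2 ^ depth i], so at that depth [k] is immovable. *)
move=> k hk le_d; apply/eqP; rewrite -hk; apply/negPn/negP => mvk.
have le_d' : (depth k <= depth i)%N := imax k mvk.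
have := fs k; rewrite !inE (negPf mvk) /= => /eqP skE; move: mvk.
rewrite skE -val_eqE val_away /alternative hk vE.
have /eqP -> : nat_of_ord (depth k) == depth i by rewrite eqn_leq le_d le_d'.
by rewrite ltnNge leq_addl /= vE eqxx.
Qed.

Lemma home_makespan_ge : (N%:R%:E <= makespan home_profile)%E.
Proof.
have m_gt0 : (0 < m)%N by apply: leq_trans le_m; rewrite expn_gt0.
apply: le_trans (load_le_makespan _ (Ordinal m_gt0)).
rewrite (load_feasible _ home_feasible) lee_fin /rload.
under eq_bigl => k do rewrite ffunE -[_ == _]andbT.
rewrite (sum_home _ predT (fun d => size_at d)).
(* Machine 0 lies below [2 ^ d] for every [d], so each depth adds 1. *)
rewrite (eq_bigr (fun=> 1)) => [|d _]; last by rewrite copies_small //= expn_gt0.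
by rewrite sumr_const card_ord.
Qed.

Lemma away_makespan_le : (makespan away_profile <= 3%:E)%E.
Proof.
apply: bigmax_le => // v _; rewrite (load_feasible _ away_feasible) lee_fin.
rewrite /rload; under eq_bigl => k do rewrite ffunE -val_eqE val_away.
rewrite (sum_tree_jobs (fun t => alternative t.1 t.2 == v) (fun t => size_at t.2)).
(* [P1] describes the immovable jobs of [v], of length 2 per depth, and [P2] the movable ones
   arriving at [v], of length 1 per depth. Either condition forces [2 ^ d <= v < 2 ^ d.+1], so only
   one depth occurs. *)
pose P1 (t : 'I_m * 'I_N) := (t.1 == v) && (2 ^ t.2 <= t.1 < 2 ^ t.2.+1)%N.
pose P2 (t : 'I_m * 'I_N) := (t.1 < 2 ^ t.2)%N && (t.1 + 2 ^ t.2 == v)%N.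
apply: (@le_trans _ _ (\sum_(t | P1 t) 2 + \sum_(t | P2 t) 1)).
  rewrite [in leLHS]big_mkcond [X in _ <= X + _]big_mkcond.
  rewrite [X in _ <= _ + X]big_mkcond -big_split; apply: ler_sum => -[x d] _ /=.
  rewrite /P1 /P2 /alternative /copies /=.
  case: ltnP => [lt_x|le_x] /=; first by rewrite size_atM andbF; case: ifP; rewrite ?add0r.
  rewrite val_eqE addr0; case: eqP => // _ /=; case: ifP => // _.
  by rewrite expnSr mulrnA size_atM.
have pow2_inj (d e : 'I_N) : (2 ^ d <= v < 2 ^ d.+1)%N -> (2 ^ e <= v < 2 ^ e.+1)%N -> d = e.
  move=> dv ev; apply/val_inj.
  have := trunc_log_eq (isT : 1 < 2)%N dv.
  by rewrite (trunc_log_eq (isT : 1 < 2)%N ev).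
rewrite (_ : 3 = 2 + 1 :> R); last by rewrite -natr1.
rewrite lerD // sum_at_most_one // => -[x d] [y e].
  move=> /andP[/eqP /= -> dv] /andP[/eqP /= -> ev].
  by rewrite (pow2_inj d e).
move=> /andP[/= xd /eqP xv] /andP[/= ye /eqP yv].
have de : d = e by apply: pow2_inj; rewrite expnS; lia.
by rewrite -de in ye yv *; congr pair; apply: val_inj => /=; lia.
Qed.

Lemma tree_ratio_ge : ((N%:R / 3)%:E <=
  worst_makespan (@strong_nash R m tree_instance) / opt tree_instance)%E.
Proof.
have [b [M [fb M_gt0 optE loadM]]] := opt_attained tree_instance.
have M_le : M <= 3.
  by rewrite -lee_fin -optE (le_trans (opt_le away_profile)) // away_makespan_le.
rewrite optE inver gt_eqF // lee_pdivlMr //.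
apply: (@le_trans _ _ N%:R%:E).
  by rewrite -EFinM lee_fin mulrAC ler_pdivrMr // ler_wpM2l.
apply: le_trans home_makespan_ge _.
exact/le_bigmax_cond/home_strong_nash.
Qed.

End LowerBound.

(** * From the bounds in [trunc_log 2 m] to the natural logarithm *)

Section Asymptotics.
Local Open Scope ring_scope.
Variable R : realType.

Lemma price_of_anarchy_le m :
  (price_of_anarchy R m <= (3 * (trunc_log 2 m).+1%:R)%:E)%E.
Proof. by apply: ge_ereal_sup => _ [I _ <-]; exact: nash_ratio_le. Qed.

Lemma strong_price_of_anarchy_le m :
  (strong_price_of_anarchy R m <= price_of_anarchy R m)%E.
Proof.
apply: ge_ereal_sup => _ [I _ <-].
apply: (@le_trans _ _ (worst_makespan (@nash R m I) / opt I)%E); last first.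
  by apply: ereal_sup_ubound; exists I.
have [b [M [_ M_gt0 -> _]]] := opt_attained I.
rewrite inver gt_eqF //; apply: lee_wpmul2r.
  by rewrite lee_fin invr_ge0 ltW.
apply: bigmax_le => [|s /strong_nash_nash ns]; first exact: leNye.
exact: le_bigmax_cond.
Qed.

Lemma strong_price_of_anarchy_ge m : (1 < m)%N ->
  (((trunc_log 2 m)%:R / 3)%:E <= strong_price_of_anarchy R m)%E.
Proof.
move=> m_gt1; have N_gt0 : (0 < trunc_log 2 m)%N by rewrite trunc_log_gt0.
have le_m : (2 ^ trunc_log 2 m <= m)%N by rewrite trunc_logP // ltnW.
apply: le_trans (tree_ratio_ge R N_gt0 le_m) _.
by apply: ereal_sup_ubound; exists (tree_instance R N_gt0 le_m).
Qed.

Lemma ln_trunc_log m : (0 < m)%N ->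
  (trunc_log 2 m)%:R * ln 2 <= ln (m%:R : R) <= (trunc_log 2 m).+1%:R * ln 2.
Proof.
move=> m_gt0; have /andP[lo hi] := @trunc_log_bounds 2 m isT m_gt0.
rewrite !mulr_natl -!lnXn ?ltr0n // !ler_ln ?posrE ?exprn_gt0 ?ltr0n //.
by rewrite -!natrX !ler_nat lo ltnW.
Qed.

Lemma bigTheta_ln (f : nat -> \bar R) :
  (forall m, (1 < m)%N -> ((trunc_log 2 m)%:R / 3)%:E <= f m)%E ->
  (forall m, f m <= (3 * (trunc_log 2 m).+1%:R)%:E)%E ->
  ereal_bigTheta f (fun m => ln m%:R).
Proof.
move=> lo hi; have ln2_gt0 : 0 < ln 2 :> R by rewrite ln_gt0 // ltr1n.
have fin m : (1 < m)%N -> f m \is a fin_num.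
  move=> m_gt1; rewrite fin_numElt (lt_le_trans (ltNyr _) (lo m m_gt1)) /=.
  exact: le_lt_trans (hi m) (ltry _).
split; first by exists 2%N => // m /= m_gt1; exact: fin.
(* As [N >= 1], [N + 1 <= 2 * N]. Hence [ln m <= 2 * N * ln 2 <= 6 * ln 2 * x] from [x >= N / 3],
   and [x <= 3 * (N + 1) <= 6 * N <= 6 * ln m / ln 2]. *)
rewrite qualifE; apply/asboolP; exists ((6 * ln 2)^-1, 6 / ln 2).
  by rewrite /= invr_gt0 divr_gt0 ?mulr_gt0.
exists 2%N => // m /= m_gt1; set N := trunc_log 2 m.
have N_ge1 : 1 <= N%:R :> R by rewrite ler1n trunc_log_gt0.
have /andP[] := ln_trunc_log (ltnW m_gt1); rewrite -/N => ln_ge ln_le.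
have := lo m m_gt1; have := hi m; rewrite -/N -(fineK (fin m m_gt1)) !lee_fin.
set x := fine (f m); rewrite -natr1 in ln_le * => x_le x_ge.
have ln_ge0 : 0 <= ln m%:R :> R.
  by apply: le_trans ln_ge; rewrite mulr_ge0 // ltW.
have x_ge0 : 0 <= x by lra.
rewrite (ger0_norm ln_ge0) (ger0_norm x_ge0).
split.
  rewrite mulrC ler_pdivrMr ?mulr_gt0 //; apply: (le_trans ln_le).
  by rewrite mulrA ler_pM2r //; lra.
rewrite mulrAC ler_pdivlMr //.
apply: (@le_trans _ _ (6 * (N%:R * ln 2))); last by rewrite ler_pM2l.
by rewrite mulrA ler_pM2r //; lra.
Qed.

End Asymptotics.

Theorem theorem11 (R : realType) :
  ereal_bigTheta (price_of_anarchy R) (fun m : nat => ln (m%:R%R : R)) /\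
  ereal_bigTheta (strong_price_of_anarchy R) (fun m : nat => ln (m%:R%R : R)).
Proof.
(* The strong price is at most the price of anarchy, so the lower bound for the former and the upper
   bound for the latter serve both. *)
split; apply: bigTheta_ln => m.
- move=> m_gt1; apply: le_trans (strong_price_of_anarchy_ge R m_gt1) _.
  exact: strong_price_of_anarchy_le.
- exact: price_of_anarchy_le.
- exact: strong_price_of_anarchy_ge.
- exact: le_trans (strong_price_of_anarchy_le R m) (price_of_anarchy_le R m).
Qed.
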